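(* There exists a regular band $B$ such that the free idempotent generated semigroup $\mathsf{IG}(B)$ has a maximal subgroup isomorphic to $\mathbb{Z}\oplus\mathbb{Z}$.
   Context: A band is a semigroup $B$ in which every element is idempotent ($x^2=x$ for all $x\in B$). A band is regular if it satisfies the identity $xyxzx=xyzx$. For a semigroup $S$ with set of idempotents $E=E(S)$, a pair of idempotents $e,f\in E$ (with $e=f$ allowed) is a basic pair if $\{ef,fe\}\cap\{e,f\}\neq\varnothing$ (products in $S$); in that case both $ef$ and $fe$ are idempotents of $S$. The free idempotent generated semigroup over $E$ is the semigroup given by the presentation $$\mathsf{IG}(E)=\langle E \mid e\cdot f=ef \text{ for all } e,f\in E \text{ such that } \{e,f\} \text{ is a basic pair}\rangle,$$ where $\cdot$ is concatenation in the free semigroup $E^+$ and $ef$ denotes the product of $e$ and $f$ in $S$, viewed as a single generator. For a band $B$ we have $E(B)=B$, and $\mathsf{IG}(B)$ denotes $\mathsf{IG}(E(B))$. The maximal subgroups of a semigroup are its subgroups that are maximal under inclusion, i.e. its $\mathcal{H}$-classes that contain an idempotent. *)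

(* Defs.v *)
From HB Require Import structures.
From mathcomp Require Import all_boot all_order all_algebra.
From mathcomp Require Import boolp classical_sets.

Set Implicit Arguments.
Unset Strict Implicit.
Unset Printing Implicit Defensive.

Import GRing.Theory.

Local Open Scope group_scope.
Local Open Scope quotient_scope.

Definition idempotent_elt (S : semigroupType) (x : S) : bool := x * x == x.

Definition band (B : semigroupType) : Prop := forall x : B, idempotent_elt x.

Definition regular_identity (B : semigroupType) : Prop :=
  forall x y z : B, x * y * x * z * x = x * y * z * x.

Definition regular_band (B : semigroupType) : Prop :=
  band B /\ regular_identity B.

Section FreeSemigroup.
Variable A : choiceType.

Definition free_semigroup : Type := {w : seq A | w != [::]}.

HB.instance Definition _ := Choice.on free_semigroup.

Fact fsg_mul_subproof (u v : free_semigroup) : val u ++ val v != [::].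
Proof. by case: u => -[]. Qed.

Definition fsg_mul (u v : free_semigroup) : free_semigroup :=
  Sub (val u ++ val v) (fsg_mul_subproof u v).

Fact fsg_mulA : associative fsg_mul.
Proof. by move=> u v w; apply: val_inj; rewrite /= catA. Qed.

HB.instance Definition _ := isSemigroup.Build free_semigroup fsg_mulA.

Definition fsg_gen (a : A) : free_semigroup := Sub [:: a] isT.

End FreeSemigroup.

Section QuotientSemigroup.
Variables (S : semigroupType) (R : S -> S -> Prop).

Inductive gen_cong : S -> S -> Prop :=
| GenCongRel x y of R x y : gen_cong x y
| GenCongRefl x : gen_cong x x
| GenCongSym x y of gen_cong x y : gen_cong y x
| GenCongTrans x y z of gen_cong x y & gen_cong y z : gen_cong x z
| GenCongMul x x' y y' of gen_cong x x' & gen_cong y y' :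
    gen_cong (x * y) (x' * y').

Definition gen_congb : rel S := fun x y => `[< gen_cong x y >].

Fact gen_congb_refl : reflexive gen_congb.
Proof. by move=> x; apply/asboolP; apply: GenCongRefl. Qed.

Fact gen_congb_sym : symmetric gen_congb.
Proof. by move=> x y; apply/asboolP/asboolP; apply: GenCongSym. Qed.

Fact gen_congb_trans : transitive gen_congb.
Proof.
by move=> y x z /asboolP xy /asboolP yz; apply/asboolP; apply: GenCongTrans yz.
Qed.

Canonical gen_congb_equiv :=
  EquivRel gen_congb gen_congb_refl gen_congb_sym gen_congb_trans.

Definition quotient_semigroup : Type := {eq_quot gen_congb}.

HB.instance Definition _ := Choice.on quotient_semigroup.
HB.instance Definition _ := EqQuotient.on quotient_semigroup.

Lemma quotient_eqP (x y : S) :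
  (\pi_quotient_semigroup x = \pi_quotient_semigroup y) <-> gen_cong x y.
Proof.
by split=> [/eqquotP/asboolP //|xy]; apply/eqquotP/asboolP.
Qed.

Definition qsg_mul (p q : quotient_semigroup) : quotient_semigroup :=
  \pi_quotient_semigroup (repr p * repr q).

Lemma qsg_mul_pi (x y : S) :
  qsg_mul (\pi_quotient_semigroup x) (\pi_quotient_semigroup y) =
    \pi_quotient_semigroup (x * y).
Proof.
by apply/quotient_eqP; apply: GenCongMul; apply/quotient_eqP; rewrite reprK.
Qed.

Fact qsg_mulA : associative qsg_mul.
Proof.
move=> p q r; elim/quotW: p => x; elim/quotW: q => y; elim/quotW: r => z.
by rewrite (qsg_mul_pi y z) (qsg_mul_pi x y) !qsg_mul_pi mulgA.
Qed.

HB.instance Definition _ := isSemigroup.Build quotient_semigroup qsg_mulA.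

End QuotientSemigroup.

Definition idempotents (S : semigroupType) : Type :=
  {e : S | idempotent_elt e}.

HB.instance Definition _ (S : semigroupType) := Choice.on (idempotents S).

Definition basic_pair (S : semigroupType) (e f : S) : Prop :=
  [\/ e * f = e, e * f = f, f * e = e | f * e = f].

(* The product of a basic pair is idempotent, so requiring the right-hand side
   of a relation to be a generator [g] with underlying element [e * f] excludes
   no basic pair. *)
Inductive IG_rel (S : semigroupType) :
  free_semigroup (idempotents S) -> free_semigroup (idempotents S) -> Prop :=
| IGRel (e f g : idempotents S) of
    basic_pair (val e) (val f) & val g = val e * val f :
    IG_rel (fsg_gen e * fsg_gen f) (fsg_gen g).

Lemma basic_pair_idempotent (S : semigroupType) (e f : S) :
  idempotent_elt e -> idempotent_elt f -> basic_pair e f ->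
  idempotent_elt (e * f).
Proof.
move=> /eqP ee /eqP ff; rewrite /idempotent_elt => -[]h; apply/eqP.
- by rewrite h.
- by rewrite h.
- by rewrite mulgA -(mulgA e) h ee.
- by rewrite mulgA -(mulgA e) h -mulgA ff.
Qed.

Definition IG (S : semigroupType) : semigroupType :=
  quotient_semigroup (@IG_rel S).

Local Open Scope classical_set_scope.

Definition subgroup_of (S : semigroupType) (G : set S) : Prop :=
  (forall x y, G x -> G y -> G (x * y)) /\
  (exists e, [/\ G e, (forall x, G x -> e * x = x /\ x * e = x) &
     forall x, G x -> exists y, [/\ G y, x * y = e & y * x = e]]).

Definition maximal_subgroup (S : semigroupType) (G : set S) : Prop :=
  subgroup_of G /\
  (forall H : set S, subgroup_of H -> G `<=` H -> H = G).

Definition isomorphic_to_zmod (S : semigroupType) (G : set S) (A : zmodType) :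
    Prop :=
  exists phi : A -> S,
    [/\ {morph phi : a b / (a + b)%R >-> a * b}, injective phi &
        range phi = G].

(* Main.v *)
Require Import Defs.
From HB Require Import structures.
From mathcomp Require Import all_boot all_order all_algebra.
From mathcomp Require Import boolp classical_sets.
From mathcomp Require Import ring.

Set Implicit Arguments.
Unset Strict Implicit.
Unset Printing Implicit Defensive.

Import GRing.Theory.

Local Open Scope group_scope.
Local Open Scope quotient_scope.

(** Let C be the 2 x 2 rectangular band, and let B be the direct product of C^1
(C with an identity adjoined) and C. The identity xyxzx = xyzx holds in C and
survives adjoining an identity, so B is a regular band. It has two D-classes: a
lower 4 x 4 rectangular band of elements [low i j], with rows and columns indexed
by pairs of bits, and an upper 2 x 2 one of elements [up s t]. An upper element
acts on a row or on a column by overwriting its second bit.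

Take the base idempotent e = [low base base] in IG(B). A product of lower
generators is governed by the sandwich entries
[sandwich j i] = [low base j * low i base], which are invertible in the corner
monoid e IG(B) e. An upper generator u can be absorbed between two lower ones
either to the left or to the right, and equating the results relates sandwich
entries to each other. These relations ([sandwich_col0], [sandwich_row0],
[sandwich_split_col], [sandwich_split_row]) say that only the bitwise products
of i and j matter: with x and y the entries at j = i = (1,0) and at
j = i = (0,1), they give [sandwich j i] = x^(j1 i1) y^(j2 i2). The entry at
(1,1),(1,1) is computed in two ways, as y x and as x y, so x and y commute. This
defines a homomorphism [phi] from Z (+) Z to the corner.

Every upper generator that follows a lower one can be replaced by a lower one,
so every product beginning with e reduces to some [phi v * low base j]. Hence
[phi] is onto the whole corner e IG(B) e ([phi_surj]). A subgroup containing the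
range of [phi] has identity e and so lies in the corner, which makes the range
maximal.

For injectivity, observe that both projections of B, to C^1 and to C, send basic
pairs to basic pairs, and that IG(C) is represented in a 2 x 2 Rees matrix
semigroup over Z. The two resulting homomorphisms on IG(B) read off the two
coordinates of v from [phi v] ([phi_inj]). *)

(** * Free idempotent generated semigroups *)

Section IGTheory.
Variable S : semigroupType.

Definition IG_gen (e : idempotents S) : IG S :=
  \pi_(quotient_semigroup (@IG_rel S)) (fsg_gen e).

Lemma IG_gen_mul (e f g : idempotents S) :
  basic_pair (val e) (val f) -> val g = val e * val f ->
  IG_gen e * IG_gen f = IG_gen g.
Proof.
move=> bef def_g; rewrite /IG_gen [LHS]qsg_mul_pi.
by apply/quotient_eqP/GenCongRel/IGRel.
Qed.

Lemma IG_ind (P : IG S -> Prop) :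
  (forall e, P (IG_gen e)) -> (forall q e, P q -> P (q * IG_gen e)) ->
  forall q, P q.
Proof.
move=> Pgen Pmul; elim/quotW => -[w w0].
elim/last_ind: w w0 => [//|w a IHw] w0.
have [w_nil|w_n0] := eqVneq w [::].
  suff -> : exist _ (rcons w a) w0 = fsg_gen a by apply: Pgen.
  by apply: val_inj; rewrite /= w_nil.
suff -> : exist _ (rcons w a) w0 = (exist _ w w_n0 : free_semigroup _) * fsg_gen a.
  by rewrite -qsg_mul_pi; apply: Pmul; apply: IHw.
by apply: val_inj; rewrite /= cats1.
Qed.

(** The universal property of the presentation: a map on idempotents that respects
products of basic pairs extends to IG(S). Nonempty words are evaluated through
[option T], as T need not have an identity. *)
Lemma IG_lift (T : semigroupType) (h : idempotents S -> T) :
  (forall e f g : idempotents S, basic_pair (val e) (val f) ->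
     val g = val e * val f -> h e * h f = h g) ->
  exists2 psi : IG S -> T, {morph psi : p q / p * q} &
    forall e, psi (IG_gen e) = h e.
Proof.
move=> h_rel.
pose ev (w : seq (idempotents S)) : option T :=
  foldr (fun a t => Some (oapp (fun b => h a * b) (h a) t)) None w.
have ev_cat (v w : seq (idempotents S)) s t : ev v = Some s -> ev w = Some t ->
    ev (v ++ w) = Some (s * t).
  elim: v s => [//|a v IHv] /= s [<-] evw.
  case def_v: (ev v) => [r|] /=; first by rewrite (IHv _ def_v evw) /= mulgA.
  by case: v def_v {IHv} => //= _; rewrite evw.
have ev_some (w : free_semigroup (idempotents S)) : exists t, ev (val w) == Some t.
  by case: w => -[//|a w] w_n0; eexists; apply: eqxx.
pose evf w : T := xchoose (ev_some w).
have evfE w : ev (val w) = Some (evf w) by apply/eqP/(xchooseP (ev_some w)).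
have evfM v w : evf (v * w) = evf v * evf w.
  by apply: Some_inj; rewrite -evfE; apply: ev_cat.
have evf_gen a : evf (fsg_gen a) = h a by apply: Some_inj; rewrite -evfE.
have evf_cong v w : gen_cong (@IG_rel S) v w -> evf v = evf w.
  elim=> {v w} [_ _ [e f g bef def_g]|//|//|u v w _ -> //|v v' w w' _ eq_v _ eq_w].
    by rewrite evfM !evf_gen; apply: h_rel.
  by rewrite !evfM eq_v eq_w.
have evf_repr w : evf (repr (\pi_(quotient_semigroup (@IG_rel S)) w)) = evf w.
  by apply/evf_cong/quotient_eqP; rewrite reprK.
exists (fun q => evf (repr q)) => [p q|e]; last by rewrite evf_repr evf_gen.
by rewrite [p * q]/(qsg_mul p q) evf_repr evfM.
Qed.

End IGTheory.

(** * Integer powers inside a corner monoid *)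

Section IntegerPowers.
Variables (S : semigroupType) (e : S).

(** For e idempotent, these are the elements of the local submonoid eSe. *)
Definition corner (x : S) : Prop := e * x = x /\ x * e = x.

Definition inverse_at (x x' : S) : Prop :=
  [/\ corner x, corner x', x * x' = e & x' * x = e].

Definition power_at (x x' : S) (n : int) : S :=
  match n with
  | Posz k => iter k (fun t => x * t) e
  | Negz k => iter k.+1 (fun t => x' * t) e
  end.

Hypothesis ee : e * e = e.

Lemma cornerM x y : corner x -> corner y -> corner (x * y).
Proof. by move=> [ex xe] [ey ye]; split; rewrite ?mulgA ?ex // -mulgA ye. Qed.

Lemma corner_power x x' n : inverse_at x x' -> corner (power_at x x' n).
Proof.
move=> [cx cx' _ _]; case: n => n /=; last apply: cornerM => //.
all: by elim: n => [|n IHn] /=; [split | apply: cornerM].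
Qed.

Lemma power_atS x x' n :
  inverse_at x x' -> power_at x x' (n + 1) = x * power_at x x' n.
Proof.
move=> inv_x; have [_ _ xx' _] := inv_x.
case: n => [n|[|n]]; first by rewrite -PoszD addn1.
  by rewrite /= mulgA xx' ee.
have -> : (Negz n.+1 + 1 = Negz n)%R by rewrite !NegzE; ring.
have [en _] := corner_power (Negz n) inv_x.
by rewrite -[RHS]/(x * (x' * power_at x x' (Negz n))) mulgA xx' en.
Qed.

Lemma power_atB1 x x' n :
  inverse_at x x' -> power_at x x' (n - 1) = x' * power_at x x' n.
Proof.
move=> inv_x; have [_ _ _ x'x] := inv_x.
rewrite -[in RHS](subrK 1%R n) power_atS // mulgA x'x.
by have [-> _] := corner_power (n - 1) inv_x.
Qed.

Lemma power_atD x x' m n : inverse_at x x' ->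
  power_at x x' (m + n) = power_at x x' m * power_at x x' n.
Proof.
move=> inv_x; elim/int_rec: m => [|m IHm|m IHm].
- by rewrite add0r; have [->] := corner_power n inv_x.
- have -> : (m.+1%:Z + n = m%:Z + n + 1)%R by rewrite -addn1 PoszD; ring.
  by rewrite power_atS // IHm mulgA.
- have -> : (- m.+1%:Z + n = - m%:Z + n - 1)%R by rewrite -addn1 PoszD; ring.
  have -> : (- m.+1%:Z = - m%:Z - 1)%R by rewrite -addn1 PoszD; ring.
  by rewrite !power_atB1 // IHm mulgA.
Qed.

Lemma power_at_comm x x' z n : inverse_at x x' -> corner z ->
  x * z = z * x -> power_at x x' n * z = z * power_at x x' n.
Proof.
move=> inv_x [ez ze] xz; have [[ex xe] [ex' x'e] xx' x'x] := inv_x.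
have x'z : x' * z = z * x'.
  by rewrite -{1}ze -xx' !mulgA -(mulgA x') -xz mulgA x'x ez.
elim/int_rec: n => [|n IHn|n IHn].
- by rewrite /= ez ze.
- by rewrite -[n.+1]addn1 PoszD power_atS // -mulgA IHn !mulgA xz.
- have -> : (- n.+1%:Z = - n%:Z - 1)%R by rewrite -addn1 PoszD; ring.
  by rewrite power_atB1 // -mulgA IHn !mulgA x'z.
Qed.

Lemma mulK_at x x' y : inverse_at x x' -> corner y -> x * (x' * y) = y.
Proof. by move=> [_ _ xx' _] [ey _]; rewrite mulgA xx' ey. Qed.

Lemma mulKl_at x x' y : inverse_at x x' -> corner y -> y * x' * x = y.
Proof. by move=> [_ _ _ x'x] [_ ye]; rewrite -mulgA x'x ye. Qed.

End IntegerPowers.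

(** * The band C^1 x C *)

(** The 2 x 2 rectangular band C is [bool * bool] under [rect_mul]; in the first
factor, [None] is the adjoined identity. *)
Definition rect1_rect : Type := (option (bool * bool) * (bool * bool))%type.

HB.instance Definition _ := Choice.on rect1_rect.

Definition rect_mul (c d : bool * bool) : bool * bool := (c.1, d.2).

Definition rect1_mul (c d : option (bool * bool)) : option (bool * bool) :=
  if c is Some c' then Some (if d is Some d' then rect_mul c' d' else c') else d.

Definition rect1_rect_mul (a b : rect1_rect) : rect1_rect :=
  (rect1_mul a.1 b.1, rect_mul a.2 b.2).

Fact rect1_rect_mulA : associative rect1_rect_mul.
Proof. by move=> [[?|] ?] [[?|] ?] [[?|] ?]. Qed.

HB.instance Definition _ := isSemigroup.Build rect1_rect rect1_rect_mulA.

Lemma rect1_rect_regular : regular_band rect1_rect.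
Proof.
split; first by move=> [[[i j]|] [s t]]; apply/eqP.
by move=> [[[? ?]|] [? ?]] [[[? ?]|] [? ?]] [[[? ?]|] [? ?]].
Qed.

(** * A Rees matrix representation *)

(** The 2 x 2 Rees matrix semigroup over Z with sandwich entries 0 or 1 (the
product of the two bits), with an identity adjoined. *)
Definition rees1 : Type := option (bool * int * bool).

HB.instance Definition _ := Choice.on rees1.

Definition rees1_mul (p q : rees1) : rees1 :=
  match p, q with
  | Some (i, a, j), Some (k, b, l) => Some (i, a + (j && k)%:Z + b, l)%R
  | Some _, None => p
  | None, _ => q
  end.

Fact rees1_mulA : associative rees1_mul.
Proof.
move=> [[[i a] j]|] [[[k b] l]|] [[[m c] n]|] //=.
by congr (Some (_, _, _)); ring.
Qed.

HB.instance Definition _ := isSemigroup.Build rees1 rees1_mulA.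

(** The idempotent in row i and column j has as its integer the opposite of the
sandwich entry. *)
Definition rees1_idem (c : option (bool * bool)) : rees1 :=
  omap (fun d => (d.1, - (d.1 && d.2)%:Z, d.2)%R) c.

(** Two elements of C form a basic pair when they share a row or a column; the
sandwich entry of the product then cancels one of the two integers. *)
Lemma rees1_idemM (c d : option (bool * bool)) :
  [\/ rect1_mul c d = c, rect1_mul c d = d, rect1_mul d c = c
    | rect1_mul d c = d] ->
  rees1_idem c * rees1_idem d = rees1_idem (rect1_mul c d).
Proof. by case: c d => [[[] []]|] [[[] []]|] // []. Qed.

(** Homomorphisms preserve basic pairs; here and in [basic_rect] they are the two
projections, the second one followed by the inclusion of C in C^1. *)
Lemma basic_rect1 (a b : rect1_rect) : basic_pair a b ->
  [\/ rect1_mul a.1 b.1 = a.1, rect1_mul a.1 b.1 = b.1, rect1_mul b.1 a.1 = a.1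
    | rect1_mul b.1 a.1 = b.1].
Proof.
by case=> ab; [apply: Or41|apply: Or42|apply: Or43|apply: Or44]; rewrite -[in RHS]ab.
Qed.

Lemma basic_rect (a b : rect1_rect) (c := Some a.2) (d := Some b.2) :
  basic_pair a b ->
  [\/ rect1_mul c d = c, rect1_mul c d = d, rect1_mul d c = c
    | rect1_mul d c = d].
Proof.
by case=> ab; [apply: Or41|apply: Or42|apply: Or43|apply: Or44];
  rewrite /c /d -[in RHS]ab.
Qed.

(** * Generators and sandwich entries *)

Section MaximalSubgroup.

Local Notation IGB := (IG rect1_rect).

Definition gen (a : rect1_rect) : IGB :=
  IG_gen (Sub a (rect1_rect_regular.1 a)).

Lemma gen_idempotents (e : idempotents rect1_rect) : IG_gen e = gen (val e).
Proof. by congr IG_gen; apply: val_inj. Qed.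

Lemma genM (a b : rect1_rect) : basic_pair a b -> gen a * gen b = gen (a * b).
Proof. by move=> ab; apply: IG_gen_mul. Qed.

Lemma gen_lift (T : semigroupType) (h : rect1_rect -> T) :
  (forall a b : rect1_rect, basic_pair a b -> h a * h b = h (a * b)) ->
  exists2 psi : IGB -> T, {morph psi : p q / p * q} &
    forall a, psi (gen a) = h a.
Proof.
move=> hM; have [|psi psiM psi_gen] := @IG_lift _ T (fun e => h (val e)).
  by move=> e f g ef ->; apply: hM.
by exists psi => // a; rewrite psi_gen.
Qed.

(** The lower D-class regrouped by rows i and columns j: each index takes one bit
from the C^1 factor and one from the C factor. *)
Definition low (i j : bool * bool) : IGB := gen (Some (i.1, j.1), (i.2, j.2)).
Definition up (s t : bool) : IGB := gen (None, (s, t)).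

Lemma low_row i j l : low i j * low i l = low i l.
Proof. by rewrite /low genM //; apply: Or42. Qed.

Lemma low_col i j k : low i j * low k j = low i j.
Proof. by rewrite /low genM //; apply: Or41. Qed.

(** The two elements form a basic pair exactly when the upper one fixes the row or
the column of the lower one. *)
Lemma up_low s t i j : s = i.2 \/ t = j.2 ->
  up s t * low i j = low (i.1, s) j.
Proof.
by case=> ->; rewrite /low /up genM //; [apply: Or42 | apply: Or44].
Qed.

Lemma low_up s t i j : s = i.2 \/ t = j.2 ->
  low i j * up s t = low i (j.1, t).
Proof.
by case=> ->; rewrite /low /up genM //; [apply: Or43 | apply: Or41].
Qed.

Definition base : bool * bool := (false, false).
Local Notation e := (low base base).

Definition sandwich (j i : bool * bool) : IGB := low base j * low i base.

Definition sandwich_inv (j i : bool * bool) : IGB := e * low i j * e.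

Lemma sandwich_inverse j i :
  inverse_at e (sandwich j i) (sandwich_inv j i).
Proof.
rewrite /sandwich /sandwich_inv; split.
- by split; [rewrite mulgA low_row | rewrite -mulgA low_col].
- by split; [rewrite !mulgA low_row | rewrite -mulgA low_row].
- rewrite !mulgA -(mulgA _ (low i base)) low_col -(mulgA _ (low i base)) low_row.
  by rewrite low_col low_row.
- rewrite -!mulgA (mulgA e (low base j)) low_row (mulgA _ (low base j)) low_col.
  by rewrite low_row low_col.
Qed.

Lemma corner_sandwich j i : corner e (sandwich j i).
Proof. by case: (sandwich_inverse j i). Qed.

Lemma sandwich_base_row i : sandwich base i = e.
Proof. by rewrite /sandwich low_col. Qed.

Lemma sandwich_base_col j : sandwich j base = e.
Proof. by rewrite /sandwich low_row. Qed.

(** In the coordinates of a Rees matrix semigroup with base e, the idempotent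
[low k l] carries the inverse of the sandwich entry at (l, k). *)
Lemma low_mul j k l :
  low base j * low k l = sandwich j k * sandwich_inv l k * low base l.
Proof.
rewrite /sandwich /sandwich_inv -!mulgA low_row (mulgA (low k base)) low_col.
by rewrite (mulgA (low k base)) low_row low_col.
Qed.

Lemma mul_low k l i :
  low k l * low i base = low k base * (sandwich_inv l k * sandwich l i).
Proof.
rewrite /sandwich /sandwich_inv !mulgA low_col low_row.
by rewrite -(mulgA (low k l)) low_row low_col.
Qed.

(** An upper generator next to a lower one is absorbed even when the two are not a
basic pair: rewrite [low base j] as [low base j * low k j], where the row k is
chosen to be fixed by the upper element. Any k with the right second bit will
do. *)
Lemma low_up_mul j k t :
  low base j * up k.2 t =
    sandwich j k * sandwich_inv (j.1, t) k * low base (j.1, t).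
Proof.
rewrite -low_mul -(low_up (s := k.2) (t := t) (i := k) (j := j)); last by left.
by rewrite mulgA low_col.
Qed.

Lemma up_low_mul s l i :
  up s l.2 * low i base =
    low (i.1, s) base * (sandwich_inv l (i.1, s) * sandwich l i).
Proof.
rewrite -mul_low -(up_low (s := s) (t := l.2) (i := i) (j := l)); last by right.
by rewrite -mulgA low_row.
Qed.

(** Since [up i.2 t] fixes the row i, it can be inserted for free; [sandwich_upr]
does the same with the column. Moving the inserted generator to the other side
yields the relations between sandwich entries. *)
Lemma sandwich_upl j i t :
  sandwich j i = low base j * up i.2 t * low i base.
Proof. by rewrite -mulgA up_low; [case: i | left]. Qed.

Lemma sandwich_upr j i s :
  sandwich j i = low base j * (up s j.2 * low i base).
Proof. by rewrite mulgA low_up; [case: j | right]. Qed.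

Lemma sandwich_col0 j t i : sandwich (j.1, t) (i, false) = sandwich j (i, false).
Proof. by rewrite (sandwich_upl j _ t) low_up //; left. Qed.

Lemma sandwich_row0 j i s : sandwich (j, false) (i.1, s) = sandwich (j, false) i.
Proof. by rewrite (sandwich_upr _ i s) up_low //; right. Qed.

(** Insert [up true true] into the entry at (j,0),(i,1): it fixes the row (i,1) but
moves the column (j,0) to (j,1), and the absorption is done along the row (0,1),
where the entry at (j,0) is trivial. *)
Lemma sandwich_split_col j i :
  sandwich (j, true) (i, true) =
  sandwich (j, true) (false, true) * sandwich (j, false) (i, false).
Proof.
rewrite -(sandwich_row0 j (i, false) true).
rewrite (sandwich_upl (j, false) (i, true) true).
rewrite (low_up_mul (j, false) (false, true) true) /=.
rewrite (sandwich_row0 j base true) sandwich_base_col.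
have [_ [-> _] _ _] := sandwich_inverse (j, true) (false, true).
rewrite -[in RHS](mulgA (sandwich_inv _ _)) -/(sandwich (j, true) (i, true)).
by rewrite (mulK_at (sandwich_inverse _ _)) //; apply: corner_sandwich.
Qed.

Lemma sandwich_split_row j i :
  sandwich (j, true) (i, true) =
  sandwich (j, false) (i, false) * sandwich (false, true) (i, true).
Proof.
rewrite -(sandwich_col0 (j, false) true i).
rewrite (sandwich_upr (j, true) (i, false) true).
rewrite (up_low_mul true (false, true) (i, false)) /=.
rewrite (sandwich_col0 base true i) sandwich_base_row.
have [_ [_ ->] _ _] := sandwich_inverse (false, true) (i, true).
rewrite (mulgA (low _ _)) -/(sandwich (j, true) (i, true)).
by rewrite (mulKl_at (sandwich_inverse _ _)) //; apply: corner_sandwich.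
Qed.

(** * The homomorphism from Z (+) Z *)

Lemma low_idem : e * e = e.
Proof. exact: low_row. Qed.

Local Notation x := (sandwich (true, false) (true, false)).
Local Notation x' := (sandwich_inv (true, false) (true, false)).
Local Notation y := (sandwich (false, true) (false, true)).
Local Notation y' := (sandwich_inv (false, true) (false, true)).

(** Entries whose second bits are not both 1 reduce to second bits 0; the others
split off y. *)
Lemma sandwichE j i :
  sandwich j i = (if j.1 && i.1 then x else e) * (if j.2 && i.2 then y else e).
Proof.
have row0 j1 i2 : sandwich (j1, false) (false, i2) = e.
  by rewrite (sandwich_row0 j1 base i2) sandwich_base_col.
have col0 j2 i1 : sandwich (false, j2) (i1, false) = e.
  by rewrite (sandwich_col0 base j2 i1) sandwich_base_row.
have P00 j1 i1 : sandwich (j1, false) (i1, false) = if j1 && i1 then x else e.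
  by case: j1 i1 => [] [] //.
have Prow j1 i1 i2 : sandwich (j1, false) (i1, i2) = if j1 && i1 then x else e.
  by rewrite (sandwich_row0 j1 (i1, false) i2).
have Pcol j1 j2 i1 : sandwich (j1, j2) (i1, false) = if j1 && i1 then x else e.
  by rewrite (sandwich_col0 (j1, false) j2 i1).
have P1 i1 : sandwich (false, true) (i1, true) = y.
  rewrite sandwich_split_col P00 /=.
  by have [_ ->] := corner_sandwich (false, true) (false, true).
have xe b : (if b then x else e) * e = if b then x else e.
  by case: b; [case: (corner_sandwich (true, false) (true, false))
              | exact: low_idem].
case: j i => j1 [] [i1 []] /=; rewrite ?xe //.
by rewrite sandwich_split_row P00 P1.
Qed.

(** The two splittings of the entry at (1,1),(1,1). *)
Lemma generators_commute : x * y = y * x.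
Proof.
have [ey _] := corner_sandwich (false, true) (false, true).
transitivity (sandwich (true, true) (true, true)).
  rewrite (sandwich_split_row true true).
  by rewrite (sandwichE (false, true) (true, true)) /= ey.
rewrite (sandwich_split_col true true).
by rewrite (sandwichE (true, true) (false, true)) /= ey.
Qed.

Definition phi (v : int * int) : IGB :=
  power_at e x x' v.1 * power_at e y y' v.2.

Lemma phiD : {morph phi : v w / (v + w)%R >-> v * w}.
Proof.
move=> [a b] [c d]; rewrite /phi /=.
have [inv_x inv_y] : inverse_at e x x' /\ inverse_at e y y'.
  by split; apply: sandwich_inverse.
rewrite (power_atD low_idem _ _ inv_x) (power_atD low_idem _ _ inv_y).
set xa := power_at e x x' a; set xc := power_at e x x' c.
set yb := power_at e y y' b; set yd := power_at e y y' d.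
suff xy : xc * yb = yb * xc by rewrite -!mulgA (mulgA xc) xy -!mulgA.
apply: (power_at_comm low_idem) => //; first exact: (corner_power low_idem).
apply/esym/(power_at_comm low_idem) => //; first exact: corner_sandwich.
exact/esym/generators_commute.
Qed.

Lemma corner_phi v : corner e (phi v).
Proof.
apply: cornerM; apply: corner_power;
  by [exact: low_idem | exact: sandwich_inverse].
Qed.

Lemma phi0 : phi 0%R = e.
Proof. by rewrite /phi /= low_idem. Qed.

Lemma phi_sandwich j i :
  sandwich j i = phi ((j.1 && i.1)%:Z, (j.2 && i.2)%:Z)%R.
Proof.
have [_ xe] := corner_sandwich (true, false) (true, false).
have [_ ye] := corner_sandwich (false, true) (false, true).
by rewrite sandwichE /phi /=; case: (_ && _); case: (_ && _); rewrite /= ?xe ?ye.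
Qed.

Lemma phi_sandwich_inv j i : exists v, sandwich_inv j i = phi v.
Proof.
pose v := ((j.1 && i.1)%:Z, (j.2 && i.2)%:Z)%R.
exists (- v)%R; have [_ [_ S'e] _ S'S] := sandwich_inverse j i.
rewrite -S'e -[X in _ * X]phi0 -(subrr v) phiD -phi_sandwich mulgA S'S.
by have [-> _] := corner_phi (- v)%R.
Qed.

(** Induction on the length of a word for q: lower letters multiply by sandwich
entries, and upper letters are absorbed. *)
Lemma phi_surj_row q : exists v j, e * q = phi v * low base j.
Proof.
have lowS v j k l : exists w i, phi v * low base j * low k l = phi w * low base i.
  have [w vw] := phi_sandwich_inv l k.
  exists (v + ((j.1 && k.1)%:Z, (j.2 && k.2)%:Z) + w)%R, l.
  by rewrite -mulgA low_mul !phiD -phi_sandwich -vw !mulgA.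
have genS v j a : exists w i, phi v * low base j * gen a = phi w * low base i.
  case: a => [[[k1 l1]|] [k2 l2]]; first exact: (lowS v j (k1, k2) (l1, l2)).
  (* Only the second bit of the row used to absorb [up k2 l2] is prescribed;
     (k2, k2) is one such row. *)
  rewrite -[gen _]/(up (k2, k2).2 l2) -mulgA low_up_mul -low_mul mulgA.
  exact: lowS.
elim/IG_ind: q => [a|q a [v [j IHq]]].
  by rewrite gen_idempotents -{1}low_idem -{1}phi0; apply: genS.
by rewrite gen_idempotents mulgA IHq; apply: genS.
Qed.

(** Surjectivity onto the corner: the trailing e brings the column back to the base
column. *)
Lemma phi_surj q : exists v, phi v = e * q * e.
Proof.
have [v [j ->]] := phi_surj_row q; exists v.
by rewrite -mulgA low_row; have [_ ->] := corner_phi v.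
Qed.

(** * Injectivity *)

Lemma power_rees1 (f g : rees1) (s : int) (n : int) :
  f = Some (false, s, false) -> g = Some (false, - s, false)%R ->
  power_at (Some (false, 0%R, false) : rees1) f g n =
    Some (false, n * s, false)%R.
Proof.
move=> -> ->.
have iterE (c : int) k :
    iter k (fun t => (Some (false, c, false) : rees1) * t)
      (Some (false, 0%R, false)) = Some (false, k%:Z * c, false)%R.
  elim: k => [|k IHk]; first by rewrite mul0r.
  by rewrite iterS IHk -addn1 PoszD; congr (Some (_, _, _)); rewrite /=; ring.
case: n => n; rewrite [LHS]iterE // NegzE.
by congr (Some (_, _, _)); ring.
Qed.

(** Covers both factors at once: in C^1 only x has a nonzero integer, so
(r, s) = (1, 0), and in C only y has one, so (r, s) = (0, 1). *)
Lemma phi_rees1 (psi : IGB -> rees1) (v : int * int) (r s : int) :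
  {morph psi : p q / p * q} -> psi e = Some (false, 0%R, false) ->
  psi x = Some (false, r, false) -> psi x' = Some (false, - r, false)%R ->
  psi y = Some (false, s, false) -> psi y' = Some (false, - s, false)%R ->
  psi (phi v) = Some (false, v.1 * r + v.2 * s, false)%R.
Proof.
move=> psiM psi_e psi_x psi_x' psi_y psi_y'.
have psi_power f g n : psi (power_at e f g n) = power_at (psi e) (psi f) (psi g) n.
  by case: n => n; [|rewrite /= psiM; congr (_ * _)];
     elim: n => //= n IHn; rewrite psiM IHn.
rewrite /phi psiM !psi_power psi_e (power_rees1 _ psi_x psi_x').
rewrite (power_rees1 _ psi_y psi_y').
by congr (Some (_, _, _)); rewrite /=; ring.
Qed.

Lemma phi_inj : injective phi.
Proof.
have [psi1 psi1M psi1E] : exists2 psi : IGB -> rees1, {morph psi : p q / p * q}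
    & forall a, psi (gen a) = rees1_idem a.1.
  by apply: gen_lift => a b /basic_rect1/rees1_idemM.
have [psi2 psi2M psi2E] : exists2 psi : IGB -> rees1, {morph psi : p q / p * q}
    & forall a, psi (gen a) = rees1_idem (Some a.2).
  by apply: gen_lift => a b /basic_rect/rees1_idemM.
move=> [a b] [c d] eq_phi.
have psi1_phi v : psi1 (phi v) = Some (false, v.1, false).
  rewrite (@phi_rees1 psi1 v 1 0) // /sandwich /sandwich_inv ?psi1M ?psi1E //.
  by congr (Some (_, _, _)); ring.
have psi2_phi v : psi2 (phi v) = Some (false, v.2, false).
  rewrite (@phi_rees1 psi2 v 0 1) // /sandwich /sandwich_inv ?psi2M ?psi2E //.
  by congr (Some (_, _, _)); ring.
have := congr1 psi1 eq_phi; rewrite !psi1_phi => -[->].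
by have := congr1 psi2 eq_phi; rewrite !psi2_phi => -[->].
Qed.

End MaximalSubgroup.

Theorem proposition3 :
  exists B : semigroupType,
    regular_band B /\
    exists G : set (IG B),
      maximal_subgroup G /\ isomorphic_to_zmod G (int * int)%type.
Proof.
exists rect1_rect; split; first exact: rect1_rect_regular.
exists (range phi); split; last first.
  by exists phi; split; [exact: phiD | exact: phi_inj |].
pose e := low base base; have ee : e * e = e := low_idem.
have phi_e v : e * phi v = phi v /\ phi v * e = phi v := corner_phi v.
split; first split.
- by move=> _ _ [v _ <-] [w _ <-]; exists (v + w)%R => //; apply: phiD.
- exists e; split=> [|_ [v _ <-] //|_ [v _ <-]]; first by exists 0%R; rewrite ?phi0.
  exists (phi (- v)%R); split; first by exists (- v)%R.
    by rewrite -phiD subrr phi0.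
  by rewrite -phiD addNr phi0.
move=> H [_ [f [Hf fH Hinv]]] subH; apply/seteqP; split=> // h Hh.
have He : H e by apply: subH; exists 0%R; rewrite ?phi0.
(* e lies in the group H and is idempotent, so it is the identity f of H. *)
have ef : e = f.
  have [e' [_ ee' _]] := Hinv e He.
  by rewrite -ee' -{2}ee -mulgA ee'; have [_ ->] := fH e He.
have [v phi_v] := phi_surj h; exists v => //.
by rewrite phi_v -/e ef; have [fh hf] := fH h Hh; rewrite fh hf.
Qed.
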